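(* (i) $\mathrm{DHL}[3,2]$ implies that $\mathcal{D}$ is the set of all positive even integers. (ii) $\mathrm{DHL}[4,2]$ implies that $\mathcal{D}$ contains every positive multiple of $4$. (iii) $\mathrm{DHL}[5,2]$ implies that $\min\mathcal{D}\le 6$. (iv) $\mathrm{DHL}[6,2]$ implies that $8\in\mathcal{D}$.
   Context: $\phi$ denotes Euler's totient function. $\mathcal{D}$ denotes the set of positive integers $d$ for which the equation $\phi(a)-\phi(b)=d$ has infinitely many solution pairs $(a,b)$ of positive integers. A finite set of affine-linear forms $a_1x+b_1,\ldots,a_kx+b_k$ with positive integers $a_i$ and integers $b_i$ is called admissible if for every prime $p$ there is an integer $x$ with $p\nmid (a_1x+b_1)\cdots(a_kx+b_k)$. For positive integers $k,m$, the hypothesis $\mathrm{DHL}[k,m]$ is the statement: for any admissible $k$-tuple of linear forms $a_in+b_i$ ($1\le i\le k$), there are infinitely many positive integers $n$ for which at least $m$ of the numbers $a_in+b_i$ are simultaneously prime. *)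

(* Defs.v *)
From mathcomp Require Import all_boot all_order all_algebra.
From mathcomp Require Import boolp classical_sets functions cardinality.
Set Implicit Arguments.
Unset Strict Implicit.
Unset Printing Implicit Defensive.
Local Open Scope classical_set_scope.

(* The pair (a, b) stands for the affine-linear form a x + b. *)
Definition linform := (nat * int)%type.

Definition lfeval (f : linform) (x : int) : int := (f.1%:Z * x + f.2)%R.

(* Primes are positive, so the negative of a prime number is excluded. *)
Definition primez (z : int) : bool := (0 <= z)%R && prime (absz z).

(* A finite set of k forms is given by an enumeration without repetition;
   injectivity is part of admissibility so that "k-tuple" means k distinct
   forms. *)
Definition admissible (k : nat) (F : 'I_k -> linform) : Prop :=
  [/\ injective F,
      forall i, 0 < (F i).1
    & forall p : nat, prime p ->
        exists x : int, ~~ (p%:Z %| (\prod_(i < k) lfeval (F i) x)%R)%Z].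

Definition DHL (k m : nat) : Prop :=
  forall F : 'I_k -> linform, admissible F ->
    infinite_set
      [set n : nat | 0 < n /\ m <= #|[pred i | primez (lfeval (F i) n%:Z)]|].

(* The difference is taken in int, as subtraction on nat is truncated. *)
Definition totient_diffs : set nat :=
  [set d : nat | 0 < d /\
    infinite_set
      [set ab : nat * nat | [/\ 0 < ab.1, 0 < ab.2 &
         ((totient ab.1)%:Z - (totient ab.2)%:Z = d%:Z)%R]]].

Definition is_min (A : set nat) (m : nat) : Prop := A m /\ lbound A m.

(* Main.v *)
(** If p and q are large primes then phi(m p) - phi(n q) is
    phi(m) (p - 1) - phi(n) (q - 1), so two linear forms whose prime values
    always yield the difference d arise as soon as phi(m), phi(n) balance the
    leading coefficients.  By DHL and the pigeonhole principle it is enough to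
    find an admissible tuple in which all pairs of forms have this property.
    We take the "star" 2 x + 1, 2 (a x + t) + 1 (a in A): with d = 2 e |t|, the
    first form is linked to the others when e and a e are totients, and the forms
    of a < b in A are linked when there are totients u = v + e and v with
    u a = v b.  Suitable A are {1, 2} for e = 1, {4, 6, 8} and {6, 8, 9, 12} for
    e = 2, and {6, 8, 9, 10, 12} for e = 4.  The star is admissible because the
    values at 0 are 1 and 2 t + 1, while the values at -1 are -1 and - 2 a
    modulo 2 t + 1.

    Conversely an odd d forces phi(b) = 1 and phi(a) = d + 1, which has finitely
    many solutions. *)
Require Import Defs.
From mathcomp Require Import all_boot all_order all_algebra.
From mathcomp Require Import boolp classical_sets functions cardinality.
From mathcomp Require Import cyclic zify ring.
Set Implicit Arguments.
Unset Strict Implicit.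
Unset Printing Implicit Defensive.
Local Open Scope classical_set_scope.
Import Order.TTheory GRing.Theory Num.Theory.

(** * Parity and growth of totients; odd differences *)

Lemma finite_set_natP (A : set nat) :
  finite_set A <-> exists N, forall x, A x -> x < N.
Proof.
split=> [/finite_seqP[s ->]|[N AN]]; last first.
  by apply: (sub_finite_set _ (finite_II N)) => x /AN.
exists (\max_(x <- s) x).+1 => x /= xs; rewrite ltnS.
exact: (@leq_bigmax_seq _ s xpredT (fun x : nat => x)).
Qed.

Lemma odd_totient_leq2 n : odd (totient n) -> n <= 2.
Proof.
case: n => [|[|n]] // odd_phi.
(* Euler's theorem at the base n + 1, which is -1 modulo n + 2. *)
have cop : coprime n.+1 n.+2 by rewrite coprimenS.
have /eqP := Euler_exp_totient cop.
have E : n.+1 ^ 2 = 1 %[mod n.+2].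
  by rewrite (_ : n.+1 ^ 2 = n * n.+2 + 1) ?modnMDl //; lia.
(* An odd exponent leaves n + 1 = 1 modulo n + 2, so n + 2 divides n and n = 0. *)
rewrite -(odd_double_half (totient n.+2)) odd_phi expnD -mul2n expnM.
rewrite -modnMmr -modnXm E modnXm exp1n modnMmr muln1 expn1.
by rewrite eqn_mod_dvd // subSS subn0 => /dvdn_leq; case: (n) => // k /(_ isT); lia.
Qed.

(* Euler's theorem at the base 2 bounds the odd part of n. *)
Lemma leq_totient_exp n : n <= 2 * totient n * 2 ^ totient n.
Proof.
have [->//|n_gt0] := posnP n.
have odd_leq m : odd m -> m <= 2 ^ totient m.
  case: m => [|[|m]] // om.
  have /eqP : 2 ^ totient m.+2 = 1 %[mod m.+2].
    by apply: Euler_exp_totient; rewrite coprime2n.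
  rewrite eqn_mod_dvd ?expn_gt0 // => /dvdn_leq le.
  apply: leq_trans (le _) (leq_subr _ _).
  rewrite subn_gt0 -{1}(expn0 2) ltn_exp2l // totient_gt0 //.
have pow_leq e : 2 ^ e <= 2 * totient (2 ^ e).
  by case: e => // e; rewrite totient_pfactor // mul1n expnS.
have cop := coprime_partC 2 n n.
rewrite -{1 2 3}(partnC 2 n_gt0) totient_coprime // p_part.
have phi2 : 0 < totient (2 ^ logn 2 n) by rewrite totient_gt0 expn_gt0.
have phi2' : 0 < totient n`_2^' by rewrite totient_gt0 part_gt0.
have odd2' : odd n`_2^'.
  by rewrite odd_2'nat part_pnat.
apply: leq_mul.
  by apply: leq_trans (pow_leq _) _; rewrite leq_mul2l leq_pmulr.
apply: leq_trans (odd_leq _ odd2') _; rewrite leq_exp2l // leq_pmull //.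
Qed.

Lemma totient_diffs_even d : totient_diffs d -> 2 %| d.
Proof.
move=> [d_gt0 inf]; rewrite dvdn2; apply/negP => odd_d; apply: inf.
(* This is [leq_totient_exp] at totient d + 1, enlarged so that b <= 2 fits as well. *)
pose N := (2 * d.+1 * 2 ^ d.+1).+3.
apply: (@sub_finite_set _ _ (`I_N `*` `I_N)); last first.
  by apply: finite_setX; apply: finite_II.
move=> [a b] /= [a_gt0 b_gt0 E].
have pos_a : 0 < totient a by rewrite totient_gt0.
have pos_b : 0 < totient b by rewrite totient_gt0.
have Ea : totient a = totient b + d by lia.
have odd_b : odd (totient b).
  apply/negPn/negP => even_b.
  have /odd_totient_leq2 a2 : odd (totient a) by rewrite Ea oddD (negPf even_b).
  have : totient a = 1 by case: a a_gt0 a2 {E pos_a Ea} => [|[|[|]]].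
  lia.
have b2 := odd_totient_leq2 odd_b.
have b1 : totient b = 1 by case: b b_gt0 b2 {E pos_b Ea odd_b} => [|[|[|]]].
split; last by rewrite /N; lia.
by have := leq_totient_exp a; rewrite Ea b1 add1n /N; lia.
Qed.

(** * From simultaneous primes to totient differences *)

Lemma infinite_set_bigcup_fin (I : finType) T (A : I -> set T) (B : set T) :
  infinite_set B -> B `<=` \bigcup_i A i -> exists i, infinite_set (A i).
Proof.
move=> inf sub; apply/not_existsP => fin; apply: inf.
apply: sub_finite_set sub _; apply: bigcup_finite => [|i _].
  exact: finite_finset.
exact: contrapT (fin i).
Qed.

(* If two such forms take prime values p and q at the same large argument, then
   totient (m * p) and totient (n * q) differ by d. *)
Definition linked (d : nat) (f g : linform) : Prop :=
  exists m n : nat,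
    [/\ 0 < m, 0 < n, totient m * f.1 = totient n * g.1
      & (`|(totient m)%:Z * (f.2 - 1) - (totient n)%:Z * (g.2 - 1)| = d%:Z)%R].

Lemma linkedC d f g : linked d f g -> linked d g f.
Proof. by move=> [m [n [? ? ? E]]]; exists n, m; split=> //; rewrite distrC. Qed.

Lemma totient_mul_prime (m p : nat) :
  0 < m -> m < p -> prime p -> totient (m * p) = totient m * p.-1.
Proof.
move=> m_gt0 mp p_pr.
rewrite totient_coprime ?(totient_prime p_pr) //.
by rewrite coprime_sym prime_coprime // gtnNdvd.
Qed.

Lemma totient_diffs_linked d f g :
    0 < d -> 0 < f.1 -> 0 < g.1 -> linked d f g ->
    infinite_set
      [set n : nat | primez (lfeval f n%:Z%R) && primez (lfeval g n%:Z%R)] ->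
  totient_diffs d.
Proof.
(* Swapping f and g removes the absolute value in [linked]. *)
move=> d_gt0; wlog [m [n [m0 n0 E1 E2]]] : f g /
    exists m n : nat, [/\ 0 < m, 0 < n, totient m * f.1 = totient n * g.1
      & ((totient m)%:Z * (f.2 - 1) - (totient n)%:Z * (g.2 - 1) = d%:Z)%R].
  move=> IH f0 g0 link inf; have [m [n [m0 n0 E1 E2]]] := link.
  have [D|D] := leP 0%R
    ((totient m)%:Z * (f.2 - 1) - (totient n)%:Z * (g.2 - 1))%R.
    by apply: IH inf => //; exists m, n; split=> //; rewrite -E2 ger0_norm.
  apply: (IH g f) => //; last by under eq_set do rewrite andbC.
    by exists n, m; split=> //; rewrite -E2 ltr0_norm // opprB.
  exact: linkedC.
move=> f0 g0 _ inf; split=> // fin; apply: inf.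
have /finite_set_natP[N Nmax] := finite_image fst fin.
(* From this bound on, p > m, q > n and m * p >= N, where N exceeds every first coordinate. *)
apply/finite_set_natP; exists (N + m + n + `|f.2| + `|g.2|)%N => x /=.
case/andP=> /andP[fpos fpr] /andP[gpos gpr]; rewrite ltnNge; apply/negP => xbig.
have fx : (x <= f.1 * x)%N by rewrite leq_pmull.
have gx : (x <= g.1 * x)%N by rewrite leq_pmull.
move: fpos fpr gpos gpr; rewrite /lfeval.
case Ep : (f.1%:Z * x%:Z + f.2)%R => [p|//] _ p_pr.
case Eq : (g.1%:Z * x%:Z + g.2)%R => [q|//] _ q_pr.
rewrite /= in p_pr q_pr.
have mp : m < p by lia.
have nq : n < q by lia.
have Np : N <= m * p by rewrite (leq_trans _ (leq_pmull p m0)) //; lia.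
suff /Nmax : [set ab.1 | ab in [set ab : nat * nat | [/\ 0 < ab.1, 0 < ab.2 &
    ((totient ab.1)%:Z - (totient ab.2)%:Z = d%:Z)%R]]] (m * p).
  by rewrite ltnNge Np.
exists (m * p, n * q) => //=; split.
- by rewrite muln_gt0 m0 prime_gt0.
- by rewrite muln_gt0 n0 prime_gt0.
rewrite !totient_mul_prime //.
have pred_prime r : prime r -> (r.-1%:Z = r%:Z - 1)%R.
  by move/prime_gt0; lia.
have E1' : ((totient m)%:Z * f.1%:Z = (totient n)%:Z * g.1%:Z)%R by lia.
rewrite !PoszM !pred_prime // -Ep -Eq -E2 -!addrA !mulrDr !mulrA E1'; ring.
Qed.

Lemma DHL_linked k (F : 'I_k -> linform) d :
    DHL k 2 -> admissible F -> 0 < d ->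
    (forall i j : 'I_k, i < j -> linked d (F i) (F j)) ->
  totient_diffs d.
Proof.
move=> dhl admF d_gt0 link; have [_ Fpos _] := admF.
(* With i < j inside the set, every other pair gives the empty set, so an infinite one is
   ordered. *)
pose A (ij : 'I_k * 'I_k) := [set n : nat | ij.1 < ij.2 /\
  (primez (lfeval (F ij.1) n%:Z%R) && primez (lfeval (F ij.2) n%:Z%R))].
have [|[i j] infA] := @infinite_set_bigcup_fin _ _ A _ (dhl F admF).
  move=> n /= [_ /card_gt1P[i [j [Pi Pj]]]].
  rewrite neq_ltn => /orP[ij|ji].
    by exists (i, j) => //=; split=> //; apply/andP; split.
  by exists (j, i) => //=; split=> //; apply/andP; split.
have ij : i < j.
  rewrite ltnNge; apply/negP => ji; apply: infA.
  by apply: sub_finite_set (finite_set0 _) => n /= []; rewrite ltnNge ji.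
apply: (@totient_diffs_linked _ _ _ d_gt0 (Fpos i) (Fpos j) (link _ _ ij)).
by apply: contra_not infA; apply: sub_finite_set => n [].
Qed.

(** * Admissibility and links of the star *)

Definition star (t : int) (A : seq nat) : seq linform :=
  (2, 1%R) :: [seq (2 * a, (2 * t + 1)%R) | a <- A].

Lemma ndvd2_odd (t : int) p :
  prime p -> p %| `|(2 * t + 1)%R| -> ~~ (p %| 2).
Proof.
move=> p_pr p_t; rewrite dvdn_prime2 //; apply/eqP => Ep; move: p_t.
suff /negPf : ~~ (2%:Z %| (2 * t + 1)%R)%Z by rewrite Ep dvdzE => ->.
lia.
Qed.

Lemma admissible_star (t : int) (A : seq nat) :
    t != 0%R -> uniq A -> all (leq 1) A ->
    (forall p, prime p -> p %| `|(2 * t + 1)%R| -> {in A, forall a, ~~ (p %| a)}) ->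
  admissible (fun i : 'I_(size A).+1 => nth (1, 0%R) (star t A) i).
Proof.
move=> t0 uA posA ndvd.
have szA : size (star t A) = (size A).+1 by rewrite /= size_map.
split=> [i j /eqP|i|p p_pr].
(* The center differs from the other forms because t != 0. *)
- rewrite nth_uniq ?szA //; first by move/eqP/val_inj.
  rewrite /= map_inj_uniq ?uA ?andbT; last by move=> a b []; lia.
  by apply/mapP => -[a _ []] _; lia.
- have : nth (1, 0%R) (star t A) i \in star t A by rewrite mem_nth ?szA.
  rewrite inE => /predU1P[->//|/mapP[a /(allP posA) a0 ->]] /=; lia.
suff [x xP] : exists x, {in star t A, forall f, ~~ (p %| `|lfeval f x|)}.
  exists x; rewrite dvdzE; apply: (big_ind (fun z : int => ~~ (p %| `|z|))).
  - by rewrite Euclid_dvd1.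
  - by move=> y z py pz; rewrite abszM Euclid_dvdM // negb_or py.
  - by move=> i _; apply: xP; rewrite mem_nth ?szA.
have [p_t|p_t] := boolP (p %| `|(2 * t + 1)%R|).
  exists (-1)%R => f; rewrite inE => /predU1P[->|/mapP[a aA ->]].
    by rewrite (_ : lfeval _ _ = -1)%R // abszN Euclid_dvd1.
  have p2 := ndvd2_odd p_pr p_t.
  have /negPf : ~~ (p %| 2 * a) by rewrite Euclid_dvdM // negb_or p2 (ndvd p).
  rewrite /lfeval /= -[p %| `|_|]/(p%:Z %| _)%Z rpredDr //.
  by rewrite mulrN1 dvdzE abszN => ->.
exists 0%R => f; rewrite inE => /predU1P[->|/mapP[a aA ->]].
  by rewrite /lfeval mulr0 add0r Euclid_dvd1.
by rewrite /lfeval mulr0 add0r.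
Qed.

(** Subtracting 1 leaves constant terms 0 at the center and 2 t elsewhere. Totients a * e and e at
    the center, or v + e and v elsewhere, both give 2 e t up to sign. The entry 1 of [1 :: A] makes
    e a totient. *)
Lemma linked_star (t : int) (A : seq nat) (e : nat) :
    0 < e -> all (leq 1) A ->
    {in 1 :: A, forall a, exists m, totient m = a * e} ->
    {in A &, forall a b, a < b -> exists m n,
       totient m * a = totient n * b /\ totient m = totient n + e} ->
  {in star t A &, forall f g, f != g -> linked (2 * e * `|t|) f g}.
Proof.
move=> e0 /allP posA phiA phiAA.
have [n En] : exists n, totient n = 1 * e by apply: phiA; rewrite mem_head.
have pos m c : totient m = c -> 0 < c -> 0 < m by move=> <-; rewrite totient_gt0.
have n0 : 0 < n by apply: pos En _; lia.
have center a : a \in A ->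
    linked (2 * e * `|t|) (2, 1%R) (2 * a, (2 * t + 1)%R).
  move=> aA; have a0 := posA _ aA.
  have [m Em] : exists m, totient m = a * e by apply: phiA; rewrite inE aA orbT.
  exists m, n; split=> //=; first by apply: pos Em _; rewrite muln_gt0 a0.
  - by rewrite En Em; lia.
  - by rewrite En Em; lia.
have rim a b : a \in A -> b \in A -> a < b ->
    linked (2 * e * `|t|) (2 * a, (2 * t + 1)%R) (2 * b, (2 * t + 1)%R).
  move=> aA bA ab; have [m [m' [E1 E2]]] := phiAA a b aA bA ab.
  have m0 : 0 < m by apply: pos E2 _; lia.
  have a0 := posA _ aA.
  have phi_m : 0 < totient m by rewrite totient_gt0.
  have m'0 : 0 < m'.
    rewrite -totient_gt0 lt0n; apply/eqP => E; move: E1; rewrite E; lia.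
  exists m, m'; split=> //=; first lia.
  have -> : ((totient m)%:Z * (2 * t + 1 - 1) - (totient m')%:Z * (2 * t + 1 - 1)
             = (2 * e)%:Z * t)%R by rewrite E2; lia.
  by rewrite normrM; lia.
move=> f g; rewrite !inE => /predU1P[->|/mapP[a aA ->]] /predU1P[->|/mapP[b bA ->]].
- by rewrite eqxx.
- by move=> _; apply: center.
- by move=> _; apply/linkedC/center.
- case: (ltngtP a b) => [ab _|ba _|->]; last by rewrite eqxx.
    exact: rim.
  exact/linkedC/rim.
Qed.

Lemma totient_diffs_star (t : int) (A : seq nat) (e : nat) :
    DHL (size A).+1 2 -> t != 0%R -> 0 < e -> uniq A -> all (leq 1) A ->
    (forall p, prime p -> p %| `|(2 * t + 1)%R| -> {in A, forall a, ~~ (p %| a)}) ->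
    {in 1 :: A, forall a, exists m, totient m = a * e} ->
    {in A &, forall a b, a < b -> exists m n,
       totient m * a = totient n * b /\ totient m = totient n + e} ->
  totient_diffs (2 * e * `|t|).
Proof.
move=> dhl t0 e0 uA posA ndvd phiA phiAA.
have admF := admissible_star t0 uA posA ndvd.
apply: (DHL_linked dhl admF); first by rewrite !muln_gt0 e0 absz_gt0.
move=> i j ij; apply: (linked_star e0 posA phiA phiAA).
- by rewrite mem_nth //= size_map.
- by rewrite mem_nth //= size_map.
- by have [injF _ _] := admF; rewrite (inj_eq injF) neq_ltn ij.
Qed.

(* Boolean, so that it is checked by computation on concrete [A] and [vs]. *)
Definition totient_chain (vs : seq nat) (e : nat) (A : seq nat) : bool :=
  all (fun a => a * e \in vs) (1 :: A) &&
  all (fun a => all (fun b => (a < b) ==>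
    has (fun v => (v + e \in vs) && ((v + e) * a == v * b)) vs) A) A.

(** N is a search bound: all witnesses are sought among 1, ..., N. *)
Lemma totient_diffs_chain (N : nat) (t : int) (A : seq nat) (e : nat) :
    DHL (size A).+1 2 -> t != 0%R -> 0 < e -> uniq A -> all (leq 1) A ->
    (forall p, prime p -> p %| `|(2 * t + 1)%R| -> {in A, forall a, ~~ (p %| a)}) ->
    totient_chain [seq totient m | m <- iota 1 N] e A ->
  totient_diffs (2 * e * `|t|).
Proof.
move=> dhl t0 e0 uA posA ndvd /andP[/allP phiA /allP phiAA].
apply: totient_diffs_star dhl t0 e0 uA posA ndvd _ _ => [a /phiA|a b aA bA ab].
  by case/mapP=> m _ ->; exists m.
have /allP/(_ b bA) := phiAA a aA; rewrite ab => /hasP[v /mapP[n _ ->]].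
by case/andP=> /mapP[m _ Em] /eqP E; exists m, n; rewrite -Em.
Qed.

Theorem theorem3 :
  [/\ DHL 3 2 -> totient_diffs = [set d : nat | 0 < d /\ 2 %| d],
      DHL 4 2 -> (forall d : nat, 0 < d -> 4 %| d -> totient_diffs d),
      DHL 5 2 -> (exists2 m : nat, is_min totient_diffs m & m <= 6)
    & DHL 6 2 -> totient_diffs 8].
Proof.
split=> dhl.
- apply/seteqP; split=> d /=.
    by move=> dd; split; [case: dd | exact: totient_diffs_even].
  case=> d0 /dvdnP[k Ed]; rewrite {}Ed in d0 *.
  rewrite (_ : k * 2 = 2 * 1 * `|k%:Z%R|); last by rewrite absz_nat muln1 mulnC.
  apply: (@totient_diffs_chain 3 _ [:: 1; 2]) => //.
  - by apply/eqP; lia.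
  - move=> p p_pr p_dvd a; rewrite !inE => /orP[/eqP->|/eqP->].
      by rewrite Euclid_dvd1.
    exact: ndvd2_odd p_pr p_dvd.
- move=> d d0 /dvdnP[k Ed]; rewrite {}Ed in d0 *.
  (* The sign of t is chosen so that the star is admissible at 3. *)
  have [t [Et t0 t3]] : exists t : int,
      [/\ `|t| = k, t != 0%R & ~~ (3 %| `|(2 * t + 1)%R|)].
    (* 3 cannot divide both 2 k + 1 and - 2 k + 1, whose sum is 2. *)
    have [k3|k3] := boolP (3 %| `|(2 * k%:Z + 1)%R|).
      by exists (- k%:Z)%R; split; lia.
    by exists k%:Z%R; split=> //; lia.
  rewrite -Et (_ : _ * 4 = 2 * 2 * `|t|); last by rewrite mulnC.
  apply: (@totient_diffs_chain 20 _ [:: 4; 6; 8]) => //.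
  move=> p p_pr p_dvd.
  have p2 := ndvd2_odd p_pr p_dvd.
  have p3 : ~~ (p %| 3).
    by rewrite dvdn_prime2 //; apply/eqP => Ep; move: p_dvd; rewrite Ep (negPf t3).
  move=> a; rewrite !inE => /or3P[] /eqP->.
  + by rewrite (Euclid_dvdM 2 2) // negb_or p2.
  + by rewrite (Euclid_dvdM 2 3) // negb_or p2.
  + by rewrite (Euclid_dvdM 2 4) // (Euclid_dvdM 2 2) // !negb_or p2.
- have D4 : totient_diffs 4.
    (* For t = -1 no prime divides 2 t + 1 = -1, so A is free of divisibility conditions, and d = 2
       e. *)
    apply: (@totient_diffs_chain 40 (-1)%R [:: 6; 8; 9; 12] 2) => //.
    by move=> p p_pr; rewrite Euclid_dvd1.
  have exD : exists m, `[< totient_diffs m >] by exists 4; apply/asboolP.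
  case: (ex_minnP exD) => m /asboolP Dm min_m; exists m.
    by split=> // d /asboolP; apply: min_m.
  by apply: leq_trans (min_m 4 _) _ => //; apply/asboolP.
(* The largest totient required, 12 * 4 = 48, first occurs at 65. *)
- apply: (@totient_diffs_chain 65 (-1)%R [:: 6; 8; 9; 10; 12] 4) => //.
  by move=> p p_pr; rewrite Euclid_dvd1.
Qed.
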